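(* Let $(\Omega,\mathcal F,\mathbb P)$ be a probability space and $\sigma\colon\Omega\to\Omega$ an invertible, measurable, $\mathbb P$-preserving and ergodic transformation. Let $(M,m)$ be a probability space and let $\mathcal B_{ss}\subset\mathcal B_s\subset\mathcal B_w\subset L^1(m)$ be Banach spaces of real-valued measurable functions on $M$ with $\|h\|_{L^1(m)}\le\|h\|_w\le\|h\|_s\le\|h\|_{ss}$. Let $\psi(\varphi)=\int_M\varphi\,dm$ and $V_s:=\{h\in\mathcal B_s:\psi(h)=0\}$. Let $I\subset(-1,1)$ be an open interval containing $0$ and for $\epsilon\in I$, $\omega\in\Omega$ let $\mathcal L_{\omega,\epsilon}$ be linear operators bounded on $\mathcal B_w,\mathcal B_s,\mathcal B_{ss}$ with $\psi\circ\mathcal L_{\omega,\epsilon}=\psi$; $\mathcal L^n_{\omega,\epsilon}:=\mathcal L_{\sigma^{n-1}\omega,\epsilon}\circ\cdots\circ\mathcal L_{\omega,\epsilon}$, $\mathcal L_\omega:=\mathcal L_{\omega,0}$. Assume there exist $C_i\in L^{p_i}(\Omega,\mathcal F,\mathbb P)$, $p_i>0$, $i\in\{0,1,2,3,4\}$, $A,B\in L^{p_5}(\Omega,\mathcal F,\mathbb P)$, $p_5>0$, $\beta>1$, and for each $\epsilon\in I$ a full-measure set $\Omega_\epsilon\subset\Omega$, such that: (1) $\|\mathcal L^n_{\sigma^{-n}\omega,\epsilon}\|_w\le C_0(\omega)$ for $n\in\mathbb N$, $\epsilon\in I$, $\omega\in\Omega_\epsilon$; (2) $\|\mathcal L^n_{\omega,\epsilon}h\|_w\le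 C_1(\omega)n^{-\beta}\|h\|_s$ for $n\in\mathbb N$, $\epsilon\in I$, $\omega\in\Omega_\epsilon$, $h\in V_s$; (3) $\|(\mathcal L_{\omega,\epsilon}-\mathcal L_\omega)h\|_w\le C_2(\omega)|\epsilon|\,\|h\|_s$ for $\epsilon\in I$, $\omega\in\Omega_\epsilon$, $h\in\mathcal B_s$; (4) for $\mathbb P$-a.e. $\omega$ there is a linear operator $\hat{\mathcal L}_\omega\colon\mathcal B_{ss}\to V_s$ with $\big\|\frac1\epsilon(\mathcal L_{\omega,\epsilon}-\mathcal L_\omega)h-\hat{\mathcal L}_\omega h\big\|_s\le C_3(\omega)|\epsilon|\,\|h\|_{ss}$ for $\epsilon\in I\setminus\{0\}$, $\omega\in\Omega_\epsilon$, $h\in\mathcal B_{ss}$, and $\|\hat{\mathcal L}_\omega h\|_s\le C_3(\omega)\|h\|_{ss}$ for $\mathbb P$-a.e. $\omega$ and all $h\in\mathcal B_{ss}$; (5) for each $\epsilon\in I$ there is a measurable family $(h_{\omega,\epsilon})_{\omega\in\Omega}\subset\mathcal B_{ss}$ with $h_{\omega,\epsilon}\ge0$, $\mathcal L_{\omega,\epsilon}h_{\omega,\epsilon}=h_{\sigma\omega,\epsilon}$, $\psi(h_{\omega,\epsilon})=1$ and $\|h_{\omega,\epsilon}\|_{ss}\le C_4(\omega)$ for each $\epsilon\in I$, $\omega\in\Omega_\epsilon$; (6) $\|\mathcal L^j_{\sigma^{-n}\omega}\|_s\le A(\sigma^{-n}\omega)B(\sigma^{j-n}\omega)$ for $\mathbb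 P$-a.e. $\omega$, $n\in\mathbb N$, $0\le j\le n$. Let $\Phi\colon\Omega\times M\to\mathbb R$ be measurable with $\Phi(\omega,\cdot)\in L^\infty(m)$ and $G(\omega):=\|\Phi(\omega,\cdot)\|_{L^\infty(m)}\in L^{p_6}(\Omega,\mathcal F,\mathbb P)$ for some $p_6>0$ with $\frac1{p_6}+\frac1{p_1}+\frac1{p_3}+\frac1{p_4}\le1$ and $\frac1{p_6}+\frac1{p_0}+\frac1{p_2}+\frac2{p_5}+\frac1{p_3}+\frac1{p_4}\le1$. Define $\int_{\Omega\times M}\Phi\,d\mu_\epsilon:=\int_\Omega\int_M\Phi(\omega,\cdot)h_{\omega,\epsilon}\,dm\,d\mathbb P(\omega)$. Then $\epsilon\mapsto\int_{\Omega\times M}\Phi\,d\mu_\epsilon$ is differentiable at $\epsilon=0$. *)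

(* Defs.v *)
From HB Require Import structures.
From mathcomp Require Import all_boot all_order all_algebra.
From mathcomp Require Import all_classical all_reals all_analysis ess_sup_inf.
Set Implicit Arguments. Unset Strict Implicit. Unset Printing Implicit Defensive.
Import Order.TTheory GRing.Theory Num.Theory.
Import numFieldNormedType.Exports.
Local Open Scope classical_set_scope.
Local Open Scope ring_scope.

Section defs.
Context {R : realType}.

Definition in_Lp d (T : measurableType d) (mu : {measure set T -> \bar R})
  (p : R) (f : T -> R) : Prop :=
  measurable_fun setT f /\ (\int[mu]_x ((`|f x| `^ p)%:E) < +oo)%E.

Definition fun_banach d (M : measurableType d) (m : {measure set M -> \bar R})
  (B : set (M -> R)) (nB : (M -> R) -> R) : Prop :=
  [/\ B (cst 0),
      (forall f g, B f -> B g -> B (f \+ g)),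
      (forall (a : R) f, B f -> B (fun x => a * f x)) &
      (forall f, B f -> 0 <= nB f)] /\
  [/\
      (forall (a : R) f, B f -> nB (fun x => a * f x) = `|a| * nB f),
      (forall f g, B f -> B g -> nB (f \+ g) <= nB f + nB g),
      (forall f, B f -> measurable_fun setT f /\
                 (\int[m]_x (`|f x|%:E) <= (nB f)%:E)%E) &
      (forall u : nat -> M -> R, (forall n, B (u n)) ->
         (forall e : R, 0 < e -> exists N, forall n k, (N <= n)%N -> (N <= k)%N ->
            nB (u n \- u k) < e) ->
         exists f, B f /\ (fun n => nB (u n \- f)) @ \oo --> (0 : R))].

Definition bounded_op (M : Type) (B : set (M -> R)) (nB : (M -> R) -> R)
  (T : (M -> R) -> (M -> R)) : Prop :=
  [/\ (forall f, B f -> B (T f)),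
      (forall (a b : R) f g, B f -> B g ->
          T (fun x => a * f x + b * g x) = (fun x => a * T f x + b * T g x)) &
      exists K : R, forall f, B f -> nB (T f) <= K * nB f].

Definition lin_op_into (M : Type) (B B' : set (M -> R))
  (T : (M -> R) -> (M -> R)) : Prop :=
  (forall f, B f -> B' (T f)) /\
  (forall (a b : R) f g, B f -> B g ->
      T (fun x => a * f x + b * g x) = (fun x => a * T f x + b * T g x)).

End defs.

Fixpoint cocycle (Om X : Type) (L : Om -> X -> X) (s : Om -> Om) (n : nat)
  (w : Om) : X -> X :=
  match n with
  | 0 => id
  | n.+1 => fun h => cocycle L s n (s w) (L w h)
  end.

Definition measure_preserving d (T : measurableType d) {R : realType}
  (P : {measure set T -> \bar R}) (s : T -> T) : Prop :=
  forall A, measurable A -> P (s @^-1` A) = P A.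

Definition ergodic d (T : measurableType d) {R : realType}
  (P : {measure set T -> \bar R}) (s : T -> T) : Prop :=
  forall A, measurable A -> s @^-1` A = A -> P A = 0%E \/ P A = 1%E.

(* Main.v *)
Require Import Defs.
From HB Require Import structures.
From mathcomp Require Import all_boot all_order all_algebra.
From mathcomp Require Import all_classical all_reals all_analysis ess_sup_inf.
From mathcomp Require Import measurable_realfun ring lra.
Set Implicit Arguments. Unset Strict Implicit. Unset Printing Implicit Defensive.
Import Order.TTheory GRing.Theory Num.Theory.
Import numFieldNormedType.Exports.
Local Open Scope classical_set_scope.
Local Open Scope ring_scope.

(* Write [w_k] for [sigma^-k w]. Iterating the equivariance of [h_e] and [h_0]
   gives, for every [n],
     [(h_e - h_0) / e = L_e^n ((h_e - h_0) / e) + sum_(j < n) L_e^j Y_(j+1)],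
   where [L_e^j] starts at [w_j] and [Y_k = (L_e - L_0) h_0 / e] at [w_k].
   By (2) the [j]-th term is [O(j^-beta)] uniformly in [e] and the remainder is
   [O(n^-beta / |e|)], while by (1), (3), (4), (6) the [j]-th term is
   [O_j(|e|)]-close to [L_0^j Lhat h_0]. The latter need not be measurable in [w],
   so it is only used pointwise, to compare the quotients at [e] and [e']: their
   difference is bounded almost everywhere by an explicit integrable function, and
   the quotients of the integrals satisfy the Cauchy criterion.

   Hoelder's inequality is replaced by the function [S = 1 + sum_i |C_i|^p_i]
   (over all the given random variables): as [|C_i| <= S^(1/p_i)], a product of
   such variables taken at several points of an orbit is at most [t^q <= t], where
   [t >= 1] is the sum of the values of [S] at these points and [q <= 1] is the sum
   of the exponents [1/p_i]. *)

(** * Real powers: smallness, tails of series, products *)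

Lemma powR_natN_small (R : realType) (s eta : R) : 0 < s -> 0 < eta ->
  exists N : nat, forall n, (N < n)%N -> n%:R `^ (- s) <= eta.
Proof.
(* The witness comes from [n > eta ^ (- 1 / s)], which forces [n ^ (- s) <= eta]. *)
move=> s0 eta0; exists (Num.truncn (eta `^ (- s^-1))) => n Nn.
have x0 : 0 <= eta `^ (- s^-1) by exact: powR_ge0.
have xn : eta `^ (- s^-1) <= n%:R.
  have := truncnS_gt (eta `^ (- s^-1)) => /ltW /le_trans; apply.
  by rewrite ler_nat.
have n0 : 0 < n%:R :> R by rewrite ltr0n (leq_ltn_trans _ Nn).
have : (eta `^ (- s^-1)) `^ s <= n%:R `^ s.
  by apply: ge0_ler_powR xn; rewrite ?nnegrE ?(ltW s0) ?(ltW n0).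
rewrite -powRrM mulNr mulVf ?gt_eqF// !powRN powRr1 ?(ltW eta0)// => h.
by rewrite -(invrK eta) lef_pV2 ?posrE ?invr_gt0 ?powR_gt0.
Qed.

(* With [s = beta - 1] and [x = 1 / n], the two tangent inequalities
   [1 - x <= exp (- x)] and [1 + s x <= exp (s x)] give
   [1 + s x <= (1 - x) ^ (- s)], which telescopes after scaling by [n ^ (- s)]. *)
Lemma powRN_le_telescope (R : realType) (beta : R) (n : nat) : 1 < beta -> (0 < n)%N ->
  n.+1%:R `^ (- beta) <=
    (beta - 1)^-1 * (n%:R `^ (1 - beta) - n.+1%:R `^ (1 - beta)).
Proof.
move=> b1 n0; set s := beta - 1.
have s0 : 0 < s by rewrite subr_gt0.
have p1 : 0 < n.+1%:R :> R by rewrite ltr0n.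
have p0 : 0 < n%:R :> R by rewrite ltr0n.
set x : R := n.+1%:R^-1.
have nE : n%:R = n.+1%:R * (1 - x) :> R.
  by rewrite mulrBr mulr1 mulfV ?gt_eqF// -natr1 addrK.
have x1 : 0 < 1 - x by rewrite -(pmulr_rgt0 _ p1) -nE.
have -> : 1 - beta = - s by rewrite opprB.
have -> : - beta = - s - 1 by rewrite /s; ring.
rewrite powRD; last by rewrite (gt_eqF p1) implybT.
rewrite powR_inv1 ?(ltW p1)// -/x nE powRM ?(ltW p1) ?(ltW x1)//.
rewrite ler_pdivlMl// -[X in _ - X]mulr1 -mulrBr mulrCA.
rewrite ler_pM2l ?powR_gt0// lerBrDl.
apply: (le_trans (expR_ge1Dx _)).
rewrite /powR gt_eqF// ler_expR mulNr -mulrN ler_pM2l// lerNr.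
rewrite -[leRHS]expRK ler_ln ?posrE ?expR_gt0//.
exact: expR_ge1Dx.
Qed.

(** Each term is at most a difference of consecutive values of [x ^ (1 - beta) / (beta - 1)]; the
    differences telescope, and the value at the upper end is dropped because of its sign. *)
Lemma powRN_sum_tail (R : realType) (beta : R) (N n : nat) : 1 < beta ->
  (0 < N)%N ->
  \sum_(N.+1 <= j < n) j%:R `^ (- beta) <= (beta - 1)^-1 * N%:R `^ (1 - beta).
Proof.
move=> b1 N0; have s0 : 0 < (beta - 1)^-1 by rewrite invr_gt0 subr_gt0.
have [nN|Nn] := leqP n N.+1.
  by rewrite big_geq//; apply: mulr_ge0; [exact: ltW|exact: powR_ge0].
case: n Nn => // n Nn; rewrite big_add1.
apply: (@le_trans _ _ (\sum_(N <= j < n)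
   ((beta - 1)^-1 * - (j.+1%:R `^ (1 - beta) - j%:R `^ (1 - beta))))).
  rewrite !big_nat; apply: ler_sum => j /andP[Nj _].
  by rewrite opprB powRN_le_telescope// (leq_trans N0).
rewrite -mulr_sumr sumrN telescope_sumr; last exact: ltnW.
by rewrite ler_pM2l// opprB gerBl powR_ge0.
Qed.

(** The product is [t] to the sum of the exponents, and a base at least [1] makes powers monotone in
    the exponent. *)
Lemma prod_powR_le (R : realType) (t : R) (l : seq R) :
  1 <= t -> \sum_(q <- l) q <= 1 -> \prod_(q <- l) t `^ q <= t.
Proof.
move=> t1 l1; have t0 : t != 0 by rewrite gt_eqF// (lt_le_trans ltr01).
have -> : \prod_(q <- l) t `^ q = t `^ \sum_(q <- l) q.
  elim: l {l1} => [|q l IH]; first by rewrite !big_nil powRr0.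
  by rewrite !big_cons IH powRD// t0 implybT.
by rewrite -[leRHS]powRr1 ?(le_trans ler01)//; exact: ler_powR.
Qed.

(** * Vector space rules for [fun_banach] *)

Section fun_banach_theory.
Context {R : realType} d (M : measurableType d) (m : {measure set M -> \bar R}).
Context (B : set (M -> R)) (nB : (M -> R) -> R) (hB : fun_banach m B nB).

Lemma fun_banach_ge0 f : B f -> 0 <= nB f.
Proof. by move: f; case: hB => -[_ _ _ +] _. Qed.

Lemma fun_banachD f g : B f -> B g -> B (f \+ g).
Proof. by move: f g; case: hB => -[_ + _ _] _. Qed.

Lemma fun_banachZ c f : B f -> B (fun x => c * f x).
Proof. by move: c f; case: hB => -[_ _ + _] _. Qed.

Lemma fun_banach_normZ c f : B f -> nB (fun x => c * f x) = `|c| * nB f.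
Proof. by move: c f; case: hB => _ [+ _ _ _]. Qed.

Lemma fun_banach_normD f g : B f -> B g -> nB (f \+ g) <= nB f + nB g.
Proof. by move: f g; case: hB => _ [_ + _ _]. Qed.

Let subE (f g : M -> R) : f \- g = f \+ (fun x => -1 * g x).
Proof. by apply/funext => x /=; rewrite mulN1r. Qed.

Lemma fun_banachB f g : B f -> B g -> B (f \- g).
Proof.
by move=> Bf Bg; rewrite subE; apply: fun_banachD => //;
  exact: fun_banachZ.
Qed.

Lemma fun_banach_normB f g : B f -> B g -> nB (f \- g) <= nB f + nB g.
Proof.
move=> Bf Bg; rewrite subE.
apply: (le_trans (fun_banach_normD Bf (fun_banachZ _ Bg))).
by rewrite fun_banach_normZ// normrN1 mul1r.
Qed.

End fun_banach_theory.

(** * Linear operators, linear forms and cocycles *)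

Definition linear_op {R : realType} (M : Type) (B : set (M -> R))
    (T : (M -> R) -> (M -> R)) :=
  forall (a b : R) f g, B f -> B g ->
    T (fun x => a * f x + b * g x) = (fun x => a * T f x + b * T g x).

Definition linear_form {R : realType} (M : Type) (B : set (M -> R))
    (phi : (M -> R) -> R) :=
  forall (a b : R) f g, B f -> B g ->
    phi (fun x => a * f x + b * g x) = a * phi f + b * phi g.

Section linear_theory.
Context {R : realType} (M : Type) (B : set (M -> R)).

Let subE (f g : M -> R) : f \- g = (fun x => 1 * f x + (-1) * g x).
Proof. by apply/funext => x /=; rewrite mulN1r mul1r. Qed.
Let addE (f g : M -> R) : f \+ g = (fun x => 1 * f x + 1 * g x).
Proof. by apply/funext => x /=; rewrite !mul1r. Qed.
Let scaleE c (f : M -> R) : (fun x => c * f x) = (fun x => c * f x + 0 * f x).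
Proof. by apply/funext => x /=; rewrite mul0r addr0. Qed.

Lemma linear_opB T f g : linear_op B T -> B f -> B g ->
  T (f \- g) = T f \- T g.
Proof. by move=> lT Bf Bg; rewrite !subE lT. Qed.

Lemma linear_opD T f g : linear_op B T -> B f -> B g ->
  T (f \+ g) = T f \+ T g.
Proof. by move=> lT Bf Bg; rewrite !addE lT. Qed.

Lemma linear_opZ T c f : linear_op B T -> B f ->
  T (fun x => c * f x) = (fun x => c * T f x).
Proof. by move=> lT Bf; rewrite !(scaleE c) lT. Qed.

Lemma linear_formB T f g : linear_form B T -> B f -> B g ->
  T (f \- g) = T f - T g.
Proof. by move=> lT Bf Bg; rewrite !subE lT// mulN1r mul1r. Qed.

Lemma linear_formD T f g : linear_form B T -> B f -> B g ->
  T (f \+ g) = T f + T g.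
Proof. by move=> lT Bf Bg; rewrite !addE lT// !mul1r. Qed.

Lemma linear_formZ T c f : linear_form B T -> B f ->
  T (fun x => c * f x) = c * T f.
Proof. by move=> lT Bf; rewrite (scaleE c) lT// mul0r addr0. Qed.

Context (Om : Type) (L : Om -> (M -> R) -> M -> R) (s : Om -> Om).

Lemma cocycle_stable n w f : (forall w f, B f -> B (L w f)) -> B f ->
  B (cocycle L s n w f).
Proof. by move=> LB; elim: n w f => //= n IH w f Bf; exact/IH/LB. Qed.

Lemma cocycle_linear n w : (forall w f, B f -> B (L w f)) ->
  (forall w, linear_op B (L w)) -> linear_op B (cocycle L s n w).
Proof.
move=> LB lL; elim: n w => //= n IH w a b f g Bf Bg.
by rewrite lL// IH//; exact: LB.
Qed.

(** [cocycle] unfolds at the operator applied first; this peels off the one applied last, which is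
    the one to be exchanged when [L_e] is compared with [L_0]. *)
Lemma cocycleSr n w f :
  cocycle L s n.+1 w f = L (iter n s w) (cocycle L s n w f).
Proof. by elim: n w f => //= n IH w f; rewrite -iterS iterSr -IH. Qed.

End linear_theory.

(** * Deterministic estimates along a single past orbit *)

Section orbit.
(* [w k] is the point [sigma^-k w] of the past orbit of [w 0], [Lhat k], [h0 k] and
   [he k] are the data at that point, [s k] is the value of [S] there and
   [qi = 1 / pi]. *)
Context {R : realType} d (M : measurableType d) (m : {measure set M -> \bar R}).
Context (Bw Bs Bss : set (M -> R)) (nw ns nss : (M -> R) -> R).
Context (hBw : fun_banach m Bw nw) (hBs : fun_banach m Bs ns)
  (Bss_s : Bss `<=` Bs) (Bs_w : Bs `<=` Bw)
  (nw_s : forall f, Bs f -> nw f <= ns f)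
  (ns_ss : forall f, Bss f -> ns f <= nss f).
Context (Om : Type) (sigma : Om -> Om) (w : nat -> Om)
  (sw : forall k, sigma (w k.+1) = w k).
Context (psi phi : (M -> R) -> R) (lpsi : linear_form Bw psi)
  (lphi : linear_form Bw phi).
Context (L0 Le : Om -> (M -> R) -> M -> R) (e : R) (e0 : e != 0) (e1 : `|e| <= 1).
Context (L0w : forall x, bounded_op Bw nw (L0 x))
  (L0s : forall x, bounded_op Bs ns (L0 x))
  (Lew : forall x, bounded_op Bw nw (Le x))
  (Les : forall x, bounded_op Bs ns (Le x))
  (psiL0 : forall x f, Bw f -> psi (L0 x f) = psi f)
  (psiLe : forall x f, Bw f -> psi (Le x f) = psi f).
Context (s : nat -> R) (s1 : forall k, 1 <= s k) (q0 q1 q2 q3 q4 q5 q6 beta : R).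
Context (q0_ge0 : 0 <= q0) (q1_ge0 : 0 <= q1) (q2_ge0 : 0 <= q2)
  (q3_ge0 : 0 <= q3) (q4_ge0 : 0 <= q4) (q5_ge0 : 0 <= q5) (q6_ge0 : 0 <= q6)
  (q6134 : q6 + q1 + q3 + q4 <= 1)
  (q602534 : q6 + q0 + q2 + 2 * q5 + q3 + q4 <= 1).
Context (Lhat : nat -> (M -> R) -> M -> R) (h0 he : nat -> M -> R).
Local Notation Ln := (cocycle Le sigma).
Local Notation Ln0 := (cocycle L0 sigma).
Local Notation Vs := [set f | Bs f /\ psi f = 0].
Context
  (H1 : forall n f, Bw f -> nw (Ln n (w n) f) <= s 0 `^ q0 * nw f)
  (H2 : forall n f, (0 < n)%N -> Vs f ->
    nw (Ln n (w n) f) <= s n `^ q1 * n%:R `^ (- beta) * ns f)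
  (H3 : forall k f, Bs f -> nw (Le (w k) f \- L0 (w k) f) <= s k `^ q2 * `|e| * ns f)
  (H4V : forall k f, Bss f -> Vs (Lhat k f))
  (H4 : forall k f, Bss f ->
     ns (fun x => e^-1 * (Le (w k) f x - L0 (w k) f x) - Lhat k f x)
       <= s k `^ q3 * `|e| * nss f)
  (H4n : forall k f, Bss f -> ns (Lhat k f) <= s k `^ q3 * nss f)
  (h0ss : forall k, Bss (h0 k)) (hess : forall k, Bss (he k))
  (h0E : forall k, L0 (w k.+1) (h0 k.+1) = h0 k)
  (heE : forall k, Le (w k.+1) (he k.+1) = he k)
  (psih : forall k, psi (he k) = psi (h0 k))
  (h0n : forall k, nss (h0 k) <= s k `^ q4)
  (hen : forall k, nss (he k) <= s k `^ q4)
  (H6 : forall k j f, (0 < j)%N -> (k <= j)%N -> Bs f ->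
     ns (Ln0 k (w j) f) <= s j `^ q5 * s (j - k)%N `^ q5 * ns f)
  (Hphi : forall f, Bw f -> `|phi f| <= s 0 `^ q6 * nw f).

Let Les_st x f : Bs f -> Bs (Le x f). Proof. by case: (Les x) => + _ _; exact. Qed.
Let Lew_st x f : Bw f -> Bw (Le x f). Proof. by case: (Lew x) => + _ _; exact. Qed.
Let L0s_st x f : Bs f -> Bs (L0 x f). Proof. by case: (L0s x) => + _ _; exact. Qed.
Let L0w_st x f : Bw f -> Bw (L0 x f). Proof. by case: (L0w x) => + _ _; exact. Qed.
Let Lew_lin x : linear_op Bw (Le x). Proof. by case: (Lew x). Qed.

Let Lnw n x f : Bw f -> Bw (Ln n x f). Proof. exact: cocycle_stable. Qed.
Let Ln0s n x f : Bs f -> Bs (Ln0 n x f). Proof. exact: cocycle_stable. Qed.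
Let Ln_lin n x : linear_op Bw (Ln n x). Proof. exact: cocycle_linear. Qed.

Let LnS n f : Ln n.+1 (w n.+1) f = Ln n (w n) (Le (w n.+1) f).
Proof. by rewrite /= sw. Qed.

Let iter_w k j : (k <= j)%N -> iter k sigma (w j) = w (j - k)%N.
Proof.
elim: k => [|k IH] kj; first by rewrite subn0.
by rewrite iterS IH ?(ltnW kj)// -(sw (j - k.+1)) subnSK.
Qed.

Let Ln0Sr k j f : (k < j)%N ->
  Ln0 k.+1 (w j) f = L0 (w (j - k)%N) (Ln0 k (w j) f).
Proof. by move=> kj; rewrite cocycleSr iter_w// ltnW. Qed.

Let D n := he n \- h0 n.
Let Y n (x : M) := e^-1 * (Le (w n) (h0 n) x - L0 (w n) (h0 n) x).
(** The limit of the [j]-th term as [e] tends to [0]; neither [Le] nor [he] occurs in it. *)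
Let vhat j := phi (Ln0 j (w j) (Lhat j.+1 (h0 j.+1))).

Let Ds n : Bs (D n).
Proof. by apply: (fun_banachB hBs); apply: Bss_s. Qed.

Let Dn n : ns (D n) <= 2 * s n `^ q4.
Proof.
apply: (le_trans (fun_banach_normB hBs (Bss_s (hess n)) (Bss_s (h0ss n)))).
rewrite mulr2n mulrDl !mul1r.
by apply: lerD; (apply: (le_trans (ns_ss _)); last by []); [exact: hess|exact: h0ss].
Qed.

Let Dpsi n : psi (D n) = 0.
Proof. by rewrite (linear_formB lpsi) ?psih ?subrr//; apply/Bs_w/Bss_s. Qed.

Let Ys n : Bs (Y n).
Proof.
by apply: (fun_banachZ hBs); apply: (fun_banachB hBs);
  [apply: Les_st|apply: L0s_st]; apply: Bss_s.
Qed.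

Let hw n : Bw (h0 n). Proof. exact/Bs_w/Bss_s. Qed.

Let Ypsi n : psi (Y n) = 0.
Proof.
rewrite /Y (linear_formZ _ lpsi); last first.
  by apply: (fun_banachB hBw); [exact: Lew_st|exact: L0w_st].
rewrite (linear_formB lpsi) ?psiLe ?psiL0 ?subrr ?mulr0//.
  exact: Lew_st.
exact: L0w_st.
Qed.

Let nYhat n : ns (Y n \- Lhat n (h0 n)) <= s n `^ q3 * `|e| * s n `^ q4.
Proof.
apply: (le_trans (H4 n (h0ss n))).
by apply: ler_wpM2l; rewrite ?mulr_ge0 ?powR_ge0.
Qed.

Let nhat n : ns (Lhat n (h0 n)) <= s n `^ q3 * s n `^ q4.
Proof.
apply: (le_trans (H4n n (h0ss n))).
by apply: ler_wpM2l; rewrite ?powR_ge0.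
Qed.

Let Lhats n : Bs (Lhat n (h0 n)). Proof. by have [] := H4V n (h0ss n). Qed.

(** Here [|e| <= 1] makes the error in [H4] no larger than the bound on [Lhat], so that the estimate
    is uniform in [e]. *)
Let nY n : ns (Y n) <= 2 * (s n `^ q3 * s n `^ q4).
Proof.
have -> : Y n = (Y n \- Lhat n (h0 n)) \+ Lhat n (h0 n).
  by apply/funext => x /=; rewrite subrK.
apply: (le_trans (fun_banach_normD hBs _ (Lhats n))).
  exact: (fun_banachB hBs).
rewrite mulr2n mulrDl !mul1r; apply: lerD (nhat n).
apply: (le_trans (nYhat n)).
by rewrite mulrAC ler_piMr// mulr_ge0 ?powR_ge0.
Qed.

Let phiYs j : Bw (Ln j (w j) (Y j.+1)). Proof. exact/Lnw/Bs_w/Ys. Qed.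

Let expansion n : e^-1 * (phi (he 0%N) - phi (h0 0%N)) =
  e^-1 * phi (Ln n (w n) (D n)) + \sum_(j < n) phi (Ln j (w j) (Y j.+1)).
Proof.
elim: n => [|n ->].
  by rewrite big_ord0 addr0 /D/= (linear_formB lphi)//; exact/Bs_w/Bss_s.
rewrite big_ord_recr/= [RHS]addrA [RHS]addrAC.
congr (_ + _); rewrite sw.
(* Equivariance of both densities gives [h_e - h_0 = L_e (h_e - h_0) + (L_e - L_0) h_0], with the
   functions on the right taken one step further in the past; the last term is [e * Y]. *)
have -> : D n = Le (w n.+1) (D n.+1) \+ (fun x => e * Y n.+1 x).
  rewrite /D (linear_opB (Lew_lin _)) ?hw//; last exact/Bs_w/Bss_s.
  by apply/funext => x /=; rewrite /Y mulVKf// h0E heE; ring.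
have Bw1 : Bw (Le (w n.+1) (D n.+1)) by exact/Lew_st/Bs_w/Ds.
have Bw2 : Bw (Y n.+1) by exact/Bs_w/Ys.
rewrite (linear_opD (Ln_lin _ _))//; last exact: (fun_banachZ hBw).
rewrite (linear_opZ _ (Ln_lin _ _))//.
rewrite (linear_formD lphi); last 2 first.
- exact: Lnw.
- exact/(fun_banachZ hBw)/Lnw.
rewrite (linear_formZ _ lphi); last exact: Lnw.
by rewrite mulrDr mulKf// addrC.
Qed.

Let s_ge0 k : 0 <= s k. Proof. exact: le_trans (s1 k). Qed.

Let s_powR_le k t q : 0 <= q -> s k <= t -> s k `^ q <= t `^ q.
Proof.
by move=> q0' kt; apply: ge0_ler_powR => //; rewrite nnegrE// (le_trans (s_ge0 k)).
Qed.

(** Settles the goals left when every value of [s] in a product of nonnegative factors is enlarged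
    to a common bound [t]. *)
Ltac mono := repeat first
  [ exact: powR_ge0 | exact: normr_ge0 | exact: ler0n | exact: lexx | done
  | apply: s_powR_le | apply: mulr_ge0 | apply: ler_pM ].

(** [D n] has zero mean by [psih], so the decay [H2] applies. The exponents are those of the
    observable, of the decay and of the densities; their sum is within [q6134] since [q3 >= 0]. *)
Let remainder_le n : (0 < n)%N ->
  `|phi (Ln n (w n) (D n))| <= 2 * n%:R `^ (- beta) * (s 0%N + s n).
Proof.
move=> n0; set t := s 0%N + s n.
have s0t : s 0%N <= t by rewrite lerDl.
have snt : s n <= t by rewrite lerDr.
have t1 : 1 <= t by exact: le_trans s0t.
apply: (le_trans (Hphi (Lnw n (w n) (Bs_w (Ds n))))).
apply: (@le_trans _ _
    (t `^ q6 * (t `^ q1 * n%:R `^ (- beta) * (2 * t `^ q4)))).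
  apply: ler_pM; [mono|exact: (fun_banach_ge0 hBw (Lnw _ _ (Bs_w (Ds n))))|mono|].
  apply: (le_trans (H2 n0 _)); first by split; [exact: Ds|exact: Dpsi].
  apply: ler_pM; [mono|exact: (fun_banach_ge0 hBs (Ds n))|mono|].
  by apply: (le_trans (Dn n)); mono.
have hq : q6 + (q1 + q4) <= 1
  by move: q6134 q602534 q0_ge0 q1_ge0 q2_ge0 q3_ge0 q4_ge0 q5_ge0 q6_ge0; lra.
have := @prod_powR_le _ t [:: q6; q1; q4] t1.
rewrite !big_cons !big_nil !addr0 mulr1 => /(_ hq) ht.
have -> : t `^ q6 * (t `^ q1 * n%:R `^ (- beta) * (2 * t `^ q4)) =
  2 * n%:R `^ (- beta) * (t `^ q6 * (t `^ q1 * t `^ q4)) by ring.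
by apply: ler_wpM2l; mono.
Qed.

(** Both operators preserve [psi], so [Y] has zero mean and [H2] applies; the exponents are exactly
    those of [q6134]. As [H2] starts at [1], the term [j = 0] is left to the head of the series. *)
Let term_le j : (0 < j)%N -> `|phi (Ln j (w j) (Y j.+1))| <=
  2 * j%:R `^ (- beta) * (s 0%N + s j + s j.+1).
Proof.
move=> j0; set t := s 0%N + s j + s j.+1.
have s0t : s 0%N <= t by rewrite /t -addrA lerDl addr_ge0.
have sjt : s j <= t by rewrite /t addrAC lerDr addr_ge0.
have sj1t : s j.+1 <= t by rewrite lerDr addr_ge0.
have t1 : 1 <= t by exact: le_trans s0t.
apply: (le_trans (Hphi (phiYs j))).
apply: (@le_trans _ _
    (t `^ q6 * (t `^ q1 * j%:R `^ (- beta) * (2 * (t `^ q3 * t `^ q4))))).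
  apply: ler_pM; [mono|exact: (fun_banach_ge0 hBw (phiYs j))|mono|].
  apply: (le_trans (H2 j0 _)); first by split; [exact: Ys|exact: Ypsi].
  apply: ler_pM; [mono|exact: (fun_banach_ge0 hBs (Ys _))|mono|].
  by apply: (le_trans (nY _)); mono.
have hq : q6 + (q1 + (q3 + q4)) <= 1
  by move: q6134 q602534 q0_ge0 q1_ge0 q2_ge0 q3_ge0 q4_ge0 q5_ge0 q6_ge0; lra.
have := @prod_powR_le _ t [:: q6; q1; q3; q4] t1.
rewrite !big_cons !big_nil !addr0 mulr1 => /(_ hq) ht.
have -> : t `^ q6 * (t `^ q1 * j%:R `^ (- beta) * (2 * (t `^ q3 * t `^ q4))) =
  2 * j%:R `^ (- beta) * (t `^ q6 * (t `^ q1 * (t `^ q3 * t `^ q4))) by ring.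
by apply: ler_wpM2l; mono.
Qed.

(** The points from [w 0] to [w j.+1] are all those met in the [j]-th term; their sum is one base
    [t] for all the powers. *)
Let window j := \sum_(i < j.+2) s i.

Let s_le_window j k : (k <= j.+1)%N -> s k <= window j.
Proof.
move=> kj; rewrite /window (bigD1 (Ordinal (kj : (k < j.+2)%N)))//= lerDl.
by apply: sumr_ge0.
Qed.

Let window_ge1 j : 1 <= window j. Proof. exact: le_trans (s_le_window (leq0n _)). Qed.

Let Bw_Lhat j k : Bs (Ln0 k (w j) (Lhat j.+1 (h0 j.+1))).
Proof. exact/Ln0s/Lhats. Qed.

(** The two compositions differ in one operator, at [w i.+1] with [i = j - k.+1]: [H6] bounds the
    [k] factors [L0] applied before it, [H3] the difference, [H1] the [i] factors [Le] applied after
    it. [H6] brings [q5] twice, whence the exponents of [q602534]. *)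
Let swap_one j k : (k < j)%N ->
  `|phi (Ln (j - k) (w (j - k)%N) (Ln0 k (w j) (Lhat j.+1 (h0 j.+1)))) -
    phi (Ln (j - k.+1) (w (j - k.+1)%N) (Ln0 k.+1 (w j) (Lhat j.+1 (h0 j.+1))))|
  <= `|e| * window j.
Proof.
move=> kj; set y := Ln0 k (w j) _.
have By : Bs y by exact: Bw_Lhat.
have ij1 : (j - k.+1 < j.+1)%N by rewrite ltnS leq_subr.
set i := (j - k.+1)%N in ij1 *; have jk : (j - k)%N = i.+1 by rewrite subnSK.
have t1 := window_ge1 j; set t := window j in t1 *.
have st k' : (k' <= j.+1)%N -> s k' <= t by exact: s_le_window.
rewrite Ln0Sr// jk LnS -/y.
have B1 : Bw (Le (w i.+1) y) by exact/Lew_st/Bs_w.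
have B2 : Bw (L0 (w i.+1) y) by exact/L0w_st/Bs_w.
have B12 := fun_banachB hBw B1 B2.
rewrite -(linear_formB lphi); [|exact: Lnw|exact: Lnw].
rewrite -(linear_opB (Ln_lin _ _))//.
apply: (le_trans (Hphi (Lnw _ _ B12))).
apply: (@le_trans _ _ (t `^ q6 * (t `^ q0 * (t `^ q2 * `|e| *
    (t `^ q5 * t `^ q5 * (t `^ q3 * t `^ q4)))))).
  apply: ler_pM; [mono|exact: (fun_banach_ge0 hBw (Lnw _ _ B12))|mono; exact: st|].
  apply: (le_trans (H1 _ B12)).
  apply: ler_pM; [mono|exact: (fun_banach_ge0 hBw B12)|mono; exact: st|].
  apply: (le_trans (H3 _ By)).
  apply: ler_pM; [mono|exact: (fun_banach_ge0 hBs By)|mono; exact: st|].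
  apply: (le_trans (H6 (leq_ltn_trans (leq0n k) kj) (ltnW kj) (Lhats _))).
  apply: ler_pM; [mono|exact: (fun_banach_ge0 hBs (Lhats _))|
    mono; [exact/st/leqnSn|exact/st/leqW/leq_subr]|].
  by apply: (le_trans (nhat _)); mono; apply: st.
have hq : q6 + (q0 + (q2 + (q5 + (q5 + (q3 + q4))))) <= 1
  by move: q6134 q602534 q0_ge0 q1_ge0 q2_ge0 q3_ge0 q4_ge0 q5_ge0 q6_ge0; lra.
have := @prod_powR_le _ t [:: q6; q0; q2; q5; q5; q3; q4] t1.
rewrite !big_cons !big_nil !addr0 mulr1 => /(_ hq) ht.
have -> : t `^ q6 * (t `^ q0 * (t `^ q2 * `|e| *
    (t `^ q5 * t `^ q5 * (t `^ q3 * t `^ q4)))) = `|e| *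
   (t `^ q6 * (t `^ q0 * (t `^ q2 * (t `^ q5 * (t `^ q5 * (t `^ q3 * t `^ q4)))))).
  by ring.
by apply: ler_wpM2l; mono.
Qed.

(** The operators are exchanged one at a time, beginning with the one applied first; at [k = j] only
    [L0] is left. *)
Let swap_many j k : (k <= j)%N ->
  `|phi (Ln j (w j) (Lhat j.+1 (h0 j.+1))) -
    phi (Ln (j - k) (w (j - k)%N) (Ln0 k (w j) (Lhat j.+1 (h0 j.+1))))|
  <= k%:R * (`|e| * window j).
Proof.
elim: k => [|k IH] kj; first by rewrite subn0 subrr normr0 mul0r.
rewrite -(subrKA (phi (Ln (j - k) (w (j - k)%N) (Ln0 k (w j) (Lhat j.+1 (h0 j.+1)))))).
apply: (le_trans (ler_normD _ _)).
rewrite -natr1 mulrDl mul1r; apply: lerD; first exact/IH/ltnW.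
exact: swap_one.
Qed.

(** The factor [j.+1] counts one error from replacing [Y] by [Lhat], through [H4], and [j] errors
    from the exchanges. The first error passes to the weak norm, where [H1] controls the iterates of
    [Le]. *)
Let term_lim j :
  `|phi (Ln j (w j) (Y j.+1)) - vhat j| <= `|e| * (j.+1%:R * window j).
Proof.
rewrite -(subrKA (phi (Ln j (w j) (Lhat j.+1 (h0 j.+1))))).
apply: (le_trans (ler_normD _ _)).
rewrite -natr1 mulrDl mul1r mulrDr addrC; apply: lerD.
  by have := swap_many (leqnn j); rewrite subnn /vhat mulrCA.
have t1 := window_ge1 j; set t := window j in t1 *.
have st k' : (k' <= j.+1)%N -> s k' <= t by exact: s_le_window.
have Bl : Bs (Lhat j.+1 (h0 j.+1)) by exact: Lhats.
have BYl := fun_banachB hBs (Ys j.+1) Bl.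
rewrite -(linear_formB lphi); [|exact: phiYs|exact/Lnw/Bs_w].
rewrite -(linear_opB (Ln_lin _ _)); [|exact/Bs_w/Ys|exact: Bs_w].
apply: (le_trans (Hphi (Lnw _ _ (Bs_w BYl)))).
apply: (@le_trans _ _ (t `^ q6 * (t `^ q0 * (t `^ q3 * `|e| * t `^ q4)))).
  apply: ler_pM; [mono|exact: (fun_banach_ge0 hBw (Lnw _ _ (Bs_w BYl)))|mono; exact: st|].
  apply: (le_trans (H1 _ (Bs_w BYl))).
  apply: ler_pM; [mono|exact: (fun_banach_ge0 hBw (Bs_w BYl))|mono; exact: st|].
  apply: (le_trans (nw_s BYl)).
  by apply: (le_trans (nYhat _)); mono; exact: st.
have hq : q6 + (q0 + (q3 + q4)) <= 1
  by move: q6134 q602534 q0_ge0 q1_ge0 q2_ge0 q3_ge0 q4_ge0 q5_ge0 q6_ge0; lra.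
have := @prod_powR_le _ t [:: q6; q0; q3; q4] t1.
rewrite !big_cons !big_nil !addr0 mulr1 => /(_ hq) ht.
have -> : t `^ q6 * (t `^ q0 * (t `^ q3 * `|e| * t `^ q4)) =
   `|e| * (t `^ q6 * (t `^ q0 * (t `^ q3 * t `^ q4))) by ring.
by apply: ler_wpM2l; mono.
Qed.

(** The sum subtracted on the left does not depend on [e], hence cancels between two parameters. The
    right-hand side collects [term_lim] below [N], [term_le] from [N] on, and [remainder_le] at
    [n]. *)
Lemma orbit_quotient_bound (N n : nat) : (0 < N)%N -> (N <= n)%N ->
  `|e^-1 * (phi (he 0%N) - phi (h0 0%N)) -
    \sum_(j < N) phi (Ln0 j (w j) (Lhat j.+1 (h0 j.+1)))| <=
  `|e| * \sum_(j < N) j.+1%:R * (\sum_(i < j.+2) s i) +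
  \sum_(N <= j < n) 2 * j%:R `^ (- beta) * (s 0%N + s j + s j.+1) +
  2 * `|e|^-1 * n%:R `^ (- beta) * (s 0%N + s n).
Proof.
move=> N0 Nn; rewrite (expansion n).
rewrite -!(big_mkord xpredT (fun j => phi (Ln j (w j) (Y j.+1)))).
rewrite (big_cat_nat (leq0n N) Nn)/= big_mkord.
set a := e^-1 * _; set v := \sum_(i < N) _; set r := \sum_(N <= i < n) _.
have -> : a + (v + r) - \sum_(j < N) phi (Ln0 j (w j) (Lhat j.+1 (h0 j.+1))) =
  v - \sum_(j < N) phi (Ln0 j (w j) (Lhat j.+1 (h0 j.+1))) + r + a by ring.
apply: (le_trans (ler_normD _ _)); apply: lerD; last first.
  rewrite /a normrM normfV.
  have -> : 2 * `|e|^-1 * n%:R `^ (- beta) * (s 0%N + s n) =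
    `|e|^-1 * (2 * n%:R `^ (- beta) * (s 0%N + s n)) by ring.
  apply: ler_wpM2l; first by rewrite invr_ge0.
  exact/remainder_le/(leq_trans N0).
apply: (le_trans (ler_normD _ _)); apply: lerD.
  rewrite /v -sumrB mulr_sumr.
  apply: (le_trans (ler_norm_sum _ _ _)); apply: ler_sum => j _.
  exact: term_lim.
apply: (le_trans (ler_norm_sum _ _ _)); rewrite !big_nat.
by apply: ler_sum => j /andP[Nj _]; exact/term_le/(leq_trans N0).
Qed.

End orbit.

(** * Derivability at [0] from the Cauchy criterion *)

Lemma derivable_cauchy (R : realType) (f : R -> R) :
  (forall eta, 0 < eta -> exists2 delta, 0 < delta &
    forall e e', e != 0 -> e' != 0 -> `|e| < delta -> `|e'| < delta ->
    `|e^-1 * (f e - f 0) - e'^-1 * (f e' - f 0)| <= eta) ->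
  derivable f 0 1.
Proof.
move=> H; rewrite /derivable; apply/cauchy_cvgP/cauchy_exP => eps eps0.
have [|delta d0 Hd] := H (eps / 2); first by rewrite divr_gt0.
(* Completeness asks for some ball of radius [eps] that eventually contains the quotients: the
   quotient at [delta / 2] is its centre, and [eps / 2] makes the inequality strict. *)
exists ((delta / 2)^-1 * (f (delta / 2) - f 0)).
have d2 : delta / 2 != 0 by rewrite gt_eqF// divr_gt0.
exists delta => //= h; rewrite /ball_/= sub0r normrN => hd h0.
rewrite /ball/= addr0 [h *: 1]mulr1 -[h^-1 *: _]/(h^-1 * _).
apply: (@le_lt_trans _ _ (eps / 2)); last by rewrite ltr_pdivrMr// ltr_pMr// ltr1n.
apply: Hd => //.
by rewrite gtr0_norm ?divr_gt0// ltr_pdivrMr// ltr_pMr// ltr1n.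
Qed.

(** * Integration against [m] as a linear form on the function spaces *)

Section integral_forms.
Context {R : realType} d (M : measurableType d) (m : probability M R).
Context (B : set (M -> R)) (nB : (M -> R) -> R) (hB : fun_banach m B nB).

Lemma fun_banach_measurable f : B f -> measurable_fun setT f.
Proof. by move=> Bf; case: hB => _ [_ _ /(_ f Bf)[]]. Qed.

Lemma fun_banach_le_norm f : B f -> (\int[m]_x (`|f x|%:E) <= (nB f)%:E)%E.
Proof. by move=> Bf; case: hB => _ [_ _ /(_ f Bf)[]]. Qed.

Lemma fun_banach_integrable f : B f -> m.-integrable setT (EFin \o f).
Proof.
move=> Bf; apply/integrableP; split.
  exact/measurable_EFinP/fun_banach_measurable.
exact: le_lt_trans (fun_banach_le_norm Bf) (ltry _).
Qed.

Lemma linear_form_Rintegral : linear_form B (Rintegral m setT).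
Proof.
move=> a b f g /fun_banach_integrable fi /fun_banach_integrable gi.
rewrite -!RintegralZl// RintegralD//.
- exact: (integrableZl _ a fi).
- exact: (integrableZl _ b gi).
Qed.

Context (u : M -> R) (mu_ : measurable_fun setT u)
  (u_fin : (ess_sup m (fun x => (`|u x|)%:E) < +oo)%E).
Let U := fine (ess_sup m (fun x => (`|u x|)%:E)).

(** [fine] is harmless: [u_fin] excludes [+oo], and [-oo] cannot bound a real number from above. The
    absolute value around [U] spares a discussion of its sign. *)
Lemma ae_le_fine_ess_sup : {ae m, forall x, `|u x| <= `|U|}.
Proof.
have := ess_sup_ge m (fun x => (`|u x|)%:E).
apply: filterS => x; rewrite /U; move: u_fin.
case: (ess_sup _ _) => //= r _; rewrite lee_fin => /le_trans; apply.
exact: ler_norm.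
Qed.

Lemma ae_bounded_mul f : B f ->
  m.-integrable setT (EFin \o (fun x => u x * f x)) /\
  `|Rintegral m setT (fun x => u x * f x)| <= `|U| * nB f.
Proof.
move=> Bf; have mf := fun_banach_measurable Bf.
have muf : measurable_fun setT (fun x => u x * f x) by exact: measurable_funM.
have le1 : (\int[m]_x (`|u x * f x|%:E) <= (`|U| * nB f)%:E)%E.
  apply: (@le_trans _ _ (\int[m]_x (`|U|%:E * `|f x|%:E))%E); last first.
    rewrite ge0_integralZl_EFin//; last exact/measurable_EFinP/measurableT_comp.
    by rewrite EFinM lee_wpmul2l ?lee_fin// fun_banach_le_norm.
  apply: ae_ge0_le_integral => //.
  - exact/measurable_EFinP/measurableT_comp.
  - apply/(measurable_EFinP _ (fun x => `|U| * `|f x|)).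
    by apply: measurable_funM => //; exact: measurableT_comp.
  apply: filterS ae_le_fine_ess_sup => x ux _.
  by rewrite lee_fin normrM ler_wpM2r.
have uf_int : m.-integrable setT (EFin \o (fun x => u x * f x)).
  apply/integrableP; split; first exact/measurable_EFinP.
  exact: le_lt_trans le1 (ltry _).
split=> //; apply: (le_trans (le_normr_Rintegral _ _)) => //.
rewrite -lee_fin; apply: le_trans le1; rewrite fineK//.
exact: integrable_fin_num (integrable_norm uf_int).
Qed.

Lemma linear_form_bounded_mul :
  linear_form B (fun f => Rintegral m setT (fun x => u x * f x)).
Proof.
move=> a b f g /ae_bounded_mul[fi _] /ae_bounded_mul[gi _].
rewrite -!RintegralZl// -RintegralD//.
- by apply: eq_Rintegral => x _; ring.
- exact: (integrableZl _ a fi).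
- exact: (integrableZl _ b gi).
Qed.

End integral_forms.

(** * Integrals and almost sure properties on a probability space *)

Section probability_integrals.
Context {R : realType} d (T : measurableType d) (P : probability T R).

(** Tonelli's theorem is applied to the positive and negative parts separately, as [f] is not
    assumed integrable on the product. *)
Lemma measurable_Rintegral_section d' (M : measurableType d')
    (m : probability M R) (f : T * M -> R) : measurable_fun setT f ->
  measurable_fun setT (fun w => Rintegral m setT (fun x => f (w, x))).
Proof.
move=> mf; apply: (measurableT_comp (fine_measurable measurableT)).
have mF : measurable_fun setT (EFin \o f) by exact/measurable_EFinP.
under eq_fun do rewrite integralE.
apply: emeasurable_funB.
- have := @measurable_fun_fubini_tonelli_F _ _ _ _ _ m _
    (measurable_funepos mF) (funepos_ge0 _).
  congr measurable_fun; apply/funext => x; apply: eq_integral => y _.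
  by rewrite !funeposE.
- have := @measurable_fun_fubini_tonelli_F _ _ _ _ _ m _
    (measurable_funeneg mF) (funeneg_ge0 _).
  congr measurable_fun; apply/funext => x; apply: eq_integral => y _.
  by rewrite !funenegE.
Qed.

Lemma ae_dominated_Rintegral (f g : T -> R) :
  measurable_fun setT f -> P.-integrable setT (EFin \o g) ->
  (forall x, 0 <= g x) ->
  {ae P, forall x, `|f x| <= g x} ->
  P.-integrable setT (EFin \o f) /\ `|Rintegral P setT f| <= Rintegral P setT g.
Proof.
move=> mf gi g0 fg.
have mg : measurable_fun setT g by exact/measurable_EFinP/(measurable_int P).
have gE : (\int[P]_x (g x)%:E)%E = (Rintegral P setT g)%:E.
  by rewrite fineK//; exact: integrable_fin_num gi.
have le1 : (\int[P]_x (`|f x|%:E) <= (Rintegral P setT g)%:E)%E.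
  rewrite -gE; apply: ae_ge0_le_integral => //.
  - exact/measurable_EFinP/measurableT_comp.
  - by move=> x _; rewrite lee_fin.
  - exact/measurable_EFinP.
  - by apply: filterS fg => x fgx _; rewrite lee_fin.
have fi : P.-integrable setT (EFin \o f).
  apply/integrableP; split; first exact/measurable_EFinP.
  exact: le_lt_trans le1 (ltry _).
split=> //; apply: (le_trans (le_normr_Rintegral _ _)) => //.
rewrite -lee_fin; apply: le_trans le1; rewrite fineK//.
exact: integrable_fin_num (integrable_norm fi).
Qed.

Lemma in_Lp_integrable p f : in_Lp P p f ->
  P.-integrable setT (EFin \o (fun x => `|f x| `^ p)).
Proof.
case=> mf fi; apply/integrableP; split.
  apply/measurable_EFinP; apply: (measurableT_comp (measurable_powR p)).
  exact: measurableT_comp.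
by under eq_integral do rewrite /= ger0_norm ?powR_ge0//.
Qed.

(** Invariance says that the image of [P] under [s] agrees with [P] on measurable sets, so this is a
    change of variables. *)
Lemma measure_preserving_Rintegral (s : T -> T) (f : T -> R) :
  measurable_fun setT s -> measure_preserving P s ->
  (forall x, 0 <= f x) -> P.-integrable setT (EFin \o f) ->
  P.-integrable setT (EFin \o (f \o s)) /\
  Rintegral P setT (f \o s) = Rintegral P setT f.
Proof.
move=> ms sP f0 fi.
have mf : measurable_fun setT f by exact/measurable_EFinP/(measurable_int P).
have E : (\int[P]_x (f (s x))%:E = \int[P]_x (f x)%:E)%E.
  have := @ge0_integral_pushforward _ _ _ _ R s ms P setT (EFin \o f)
    measurableT (proj2 (measurable_EFinP _ _) mf).
  rewrite preimage_setT => <-; last by move=> y _; rewrite /= lee_fin.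
  by apply: eq_measure_integral => A mA _; exact: sP.
split; last by rewrite /Rintegral E.
apply/integrableP; split; first exact/measurable_EFinP/measurableT_comp.
under eq_integral do rewrite /= ger0_norm//.
rewrite E; case/integrableP : fi => _.
by under eq_integral do rewrite /= ger0_norm//.
Qed.

Lemma measure_preserving_ae (s : T -> T) (Q : T -> Prop) :
  measurable_fun setT s -> measure_preserving P s ->
  {ae P, forall x, Q x} -> {ae P, forall x, Q (s x)}.
Proof.
move=> ms sP [N [mN PN QN]]; exists (s @^-1` N); split.
- by rewrite -[X in measurable X]setTI; exact: ms.
- by rewrite sP.
- by move=> x /= nQ; apply: QN.
Qed.

End probability_integrals.

(** * Integrable functions with a known mean *)

Section has_mean.
Context {R : realType} d (T : measurableType d) (P : probability T R).

(** Integrability is carried along with the value because [Rintegral] returns a real number for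
    every function; the rules below compute the mean of a majorant from its expression. *)
Definition has_mean (f : T -> R) (c : R) :=
  P.-integrable setT (EFin \o f) /\ Rintegral P setT f = c.

Lemma has_mean_cst c : has_mean (cst c) c.
Proof.
split; first exact: finite_measure_integrable_cst.
rewrite (Rintegral_cst P measurableT) -[RHS]mulr1.
by congr (_ * _); exact: (congr1 fine (probability_setT P)).
Qed.

Lemma has_meanD f g a b : has_mean f a -> has_mean g b ->
  has_mean (fun x => f x + g x) (a + b).
Proof.
move=> [fi <-] [gi <-]; split; last exact: RintegralD.
exact: (integrableD measurableT fi gi).
Qed.

Lemma has_meanZ k f a : has_mean f a -> has_mean (fun x => k * f x) (k * a).
Proof.
move=> [fi <-]; split; last exact: RintegralZl.
exact: (integrableZl measurableT k fi).
Qed.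

Lemma has_mean_sum (I : Type) (r : seq I) (f : I -> T -> R) (a : I -> R) :
  (forall i, has_mean (f i) (a i)) ->
  has_mean (fun x => \sum_(i <- r) f i x) (\sum_(i <- r) a i).
Proof.
move=> fa; elim: r => [|i r IH].
  have -> : (fun x => \sum_(i <- [::]) f i x) = cst 0.
    by apply/funext => x; rewrite big_nil.
  by rewrite big_nil; exact: has_mean_cst.
have -> : (fun x => \sum_(j <- i :: r) f j x) =
    (fun x => f i x + \sum_(j <- r) f j x).
  by apply/funext => x; rewrite big_cons.
by rewrite big_cons; exact: has_meanD.
Qed.

End has_mean.

(** * Scalar estimates for the conclusion *)

Lemma normr_le_powRV (R : realType) (p t x : R) : 0 < p ->
  `|x| `^ p <= t -> `|x| <= t `^ p^-1.
Proof.
move=> p0 xt; have -> : `|x| = (`|x| `^ p) `^ p^-1.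
  by rewrite -powRrM divff ?gt_eqF// powRr1.
apply: ge0_ler_powR => //; first by rewrite invr_ge0 ltW.
  by rewrite nnegrE powR_ge0.
by rewrite nnegrE (le_trans _ xt)// powR_ge0.
Qed.

(* The head of the series is [O(|e|)], its tail is small uniformly in [e], and
   the remainder is sent to [0] last, for fixed [e] and [e']. *)
Lemma quotient_cauchy (R : realType) (Q : R -> R) (K beta r : R) (kappa : nat -> R) :
  0 < K -> 1 < beta -> 0 < r -> (forall N, 0 <= kappa N) ->
  (forall e e' N n, e != 0 -> e' != 0 -> `|e| < r -> `|e'| < r ->
    (0 < N)%N -> (N <= n)%N ->
    `|Q e - Q e'| <= (`|e| + `|e'|) * kappa N +
      K * \sum_(N <= j < n) j%:R `^ (- beta) +
      K * (`|e|^-1 + `|e'|^-1) * n%:R `^ (- beta)) ->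
  forall eta, 0 < eta -> exists2 delta, 0 < delta &
    forall e e', e != 0 -> e' != 0 -> `|e| < delta -> `|e'| < delta ->
    `|Q e - Q e'| <= eta.
Proof.
move=> K0 b1 r0 k0 H eta eta0.
have b0 : 0 < beta - 1 by rewrite subr_gt0.
have [|N0 HN0] := @powR_natN_small R (beta - 1) (eta / 4 / (K / (beta - 1))) b0.
  by rewrite !divr_gt0.
(* [powRN_sum_tail] bounds a sum starting at [N0.+2] by a power of [N0.+1], which exceeds [N0] as
   [HN0] requires. *)
pose N := N0.+2.
have tail n : K * \sum_(N <= j < n) j%:R `^ (- beta) <= eta / 4.
  apply: (@le_trans _ _ (K * ((beta - 1)^-1 * N0.+1%:R `^ (1 - beta)))).
    by rewrite ler_pM2l// powRN_sum_tail.
  rewrite mulrA -ler_pdivlMl ?divr_gt0// mulrC -(opprB beta).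
  exact: HN0.
have k1 : 0 < kappa N + 1 by rewrite ltr_wpDl.
(* The two parameters, at [eta / 8] each, use one quarter of [eta]; tail and remainder use one
   quarter each. The added [1] keeps the denominator positive. *)
exists (Num.min r (eta / 8 / (kappa N + 1))).
  by rewrite lt_min r0 !divr_gt0.
move=> e e' en en'; rewrite !lt_min => /andP[er ed] /andP[er' ed'].
set c := K * (`|e|^-1 + `|e'|^-1).
have c0 : 0 < c by rewrite mulr_gt0// addr_gt0// invr_gt0 normr_gt0.
have [||n0 Hn0] := @powR_natN_small R beta (eta / 4 / c); first exact: lt_trans b1.
  by rewrite !divr_gt0.
pose n := (maxn N n0).+1.
have Nn : (N <= n)%N by rewrite (leq_trans (leq_maxl N n0)).
apply: (le_trans (H e e' N n en en' er er' isT Nn)).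
have r1 : c * n%:R `^ (- beta) <= eta / 4.
  by rewrite -ler_pdivlMl// mulrC; apply: Hn0; rewrite ltnS leq_maxr.
have r2 : (`|e| + `|e'|) * kappa N <= eta / 4.
  apply: (@le_trans _ _ ((`|e| + `|e'|) * (kappa N + 1))).
    by rewrite ler_wpM2l ?addr_ge0// lerDl.
  rewrite -ler_pdivlMr//.
  have -> : eta / 4 / (kappa N + 1) =
     eta / 8 / (kappa N + 1) + eta / 8 / (kappa N + 1) by field; rewrite gt_eqF.
  by apply: lerD; exact: ltW.
by have := tail n; rewrite -/c; lra.
Qed.

(** * Assembly: almost sure comparison of the quotients, then integration over [Om] *)

Theorem theorem8 (R : realType)
  (d1 d2 : measure_display)
  (Om : measurableType d1) (P : probability Om R)
  (sigma sigma_inv : Om -> Om)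
  (M : measurableType d2) (m : probability M R)
  (Bw Bs Bss : set (M -> R)) (nw ns nss : (M -> R) -> R)
  (a b : R)
  (L : R -> Om -> (M -> R) -> (M -> R))
  (C0 C1 C2 C3 C4 A B : Om -> R) (p0 p1 p2 p3 p4 p5 : R) (beta : R)
  (Omeps : R -> set Om)
  (h : R -> Om -> M -> R)
  (Phi : Om -> M -> R) (p6 : R) :
  (* sigma : invertible, measurable (with measurable inverse),
     P-preserving and ergodic *)
  measurable_fun setT sigma -> measurable_fun setT sigma_inv ->
  cancel sigma sigma_inv -> cancel sigma_inv sigma ->
  measure_preserving P sigma -> ergodic P sigma ->
  (* Banach spaces Bss ⊂ Bs ⊂ Bw ⊂ L^1(m) with comparable norms *)
  fun_banach m Bw nw -> fun_banach m Bs ns -> fun_banach m Bss nss ->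
  Bss `<=` Bs -> Bs `<=` Bw ->
  (forall f, Bs f -> nw f <= ns f) -> (forall f, Bss f -> ns f <= nss f) ->
  let psi := fun f : M -> R => Rintegral m setT f in
  let Vs := [set f | Bs f /\ psi f = 0] in
  (* I = ]a,b[ open interval with 0 ∈ I ⊂ (-1,1) *)
  -1 <= a -> a < 0 -> 0 < b -> b <= 1 ->
  let I := [set e : R | a < e < b] in
  (* transfer operators *)
  (forall e w, I e ->
     [/\ bounded_op Bw nw (L e w), bounded_op Bs ns (L e w),
         bounded_op Bss nss (L e w) &
         forall f, Bw f -> psi (L e w f) = psi f]) ->
  let Ln := fun e n w => cocycle (L e) sigma n w in
  let sigma_pow_inv := fun n w => iter n sigma_inv w in
  (* integrability data *)
  0 < p0 -> 0 < p1 -> 0 < p2 -> 0 < p3 -> 0 < p4 -> 0 < p5 ->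
  in_Lp P p0 C0 -> in_Lp P p1 C1 -> in_Lp P p2 C2 -> in_Lp P p3 C3 ->
  in_Lp P p4 C4 -> in_Lp P p5 A -> in_Lp P p5 B ->
  1 < beta ->
  (forall e, I e -> measurable (Omeps e) /\ P (Omeps e) = 1%E) ->
  (* (1) *)
  (forall n e w f, (0 < n)%N -> I e -> Omeps e w -> Bw f ->
     nw (Ln e n (sigma_pow_inv n w) f) <= C0 w * nw f) ->
  (* (2) *)
  (forall n e w f, (0 < n)%N -> I e -> Omeps e w -> Vs f ->
     nw (Ln e n w f) <= C1 w * (n%:R `^ (- beta)) * ns f) ->
  (* (3) *)
  (forall e w f, I e -> Omeps e w -> Bs f ->
     nw (L e w f \- L 0 w f) <= C2 w * `|e| * ns f) ->
  (* (4) *)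
  {ae P, forall w, exists Lhat : (M -> R) -> (M -> R),
     [/\ lin_op_into Bss Vs Lhat,
         (forall e f, I e -> e != 0 -> Omeps e w -> Bss f ->
            ns (fun x => e^-1 * (L e w f x - L 0 w f x) - Lhat f x)
              <= C3 w * `|e| * nss f) &
         (forall f, Bss f -> ns (Lhat f) <= C3 w * nss f)]} ->
  (* (5) *)
  (forall e, I e ->
     measurable_fun setT (fun q : Om * M => h e q.1 q.2) /\
     forall w, Bss (h e w) /\
       (Omeps e w ->
        [/\ (forall x, 0 <= h e w x), L e w (h e w) = h e (sigma w),
            psi (h e w) = 1 & nss (h e w) <= C4 w])) ->
  (* (6) *)
  {ae P, forall w, forall n j f, (0 < n)%N -> (j <= n)%N -> Bs f ->
     ns (Ln 0 j (sigma_pow_inv n w) f)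
       <= A (sigma_pow_inv n w) * B (sigma_pow_inv (n - j)%N w) * ns f} ->
  (* observable Phi *)
  measurable_fun setT (fun q : Om * M => Phi q.1 q.2) ->
  (forall w, (ess_sup m (fun x => (`|Phi w x|)%:E) < +oo)%E) ->
  let G := fun w => fine (ess_sup m (fun x => (`|Phi w x|)%:E)) in
  0 < p6 -> in_Lp P p6 G ->
  p6^-1 + p1^-1 + p3^-1 + p4^-1 <= 1 ->
  p6^-1 + p0^-1 + p2^-1 + 2 / p5 + p3^-1 + p4^-1 <= 1 ->
  let mu_int := fun e : R =>
    Rintegral P setT (fun w => Rintegral m setT (fun x => Phi w x * h e w x)) in
  derivable mu_int 0 1.
Proof.
move=> msigma msigma_inv sK siK sP _ hBw hBs hBss Bss_s Bs_w nw_s ns_ss psi Vs.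
move=> a1 a0 b0 b1 I Lop Ln sigma_pow_inv p0_gt0 p1_gt0 p2_gt0 p3_gt0 p4_gt0 p5_gt0.
move=> C0L C1L C2L C3L C4L AL BL beta1 Omeps1 H1 H2 H3 H4 H5 H6 mPhi Phi_fin G.
move=> p6_gt0 GL q6134 q602534 mu_int.
have I0 : I 0 by rewrite /I/= a0 b0.
have q0_ge0 : 0 <= p0^-1 by rewrite invr_ge0 ltW.
have q1_ge0 : 0 <= p1^-1 by rewrite invr_ge0 ltW.
have q2_ge0 : 0 <= p2^-1 by rewrite invr_ge0 ltW.
have q3_ge0 : 0 <= p3^-1 by rewrite invr_ge0 ltW.
have q4_ge0 : 0 <= p4^-1 by rewrite invr_ge0 ltW.
have q5_ge0 : 0 <= p5^-1 by rewrite invr_ge0 ltW.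
have q6_ge0 : 0 <= p6^-1 by rewrite invr_ge0 ltW.
have siP : measure_preserving P sigma_inv.
  move=> E mE; rewrite -sP; last by rewrite -[X in measurable X]setTI; exact: msigma_inv.
  by congr (P _); apply/seteqP; split => x /=; rewrite sK.
have iter_mp k : measurable_fun setT (iter k sigma_inv) /\
    measure_preserving P (iter k sigma_inv).
  elim: k => [|k [mk Pk]]; first by split; [exact: measurable_id|move=> ? _].
  split; first exact: (measurableT_comp msigma_inv mk).
  move=> E mE; rewrite -(siP _ mE); apply: Pk.
  by rewrite -[X in measurable X]setTI; exact: msigma_inv.
(* Invariance carries a full-measure set to each point of the past orbit, and countably many such
   sets are intersected. *)
have ae_orbit (Q : Om -> Prop) : {ae P, forall w, Q w} ->
    {ae P, forall w, forall k, Q (iter k sigma_inv w)}.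
  move=> QP; apply: ae_foralln => k; have [mk Pk] := iter_mp k.
  exact: measure_preserving_ae QP.
have ae_Omeps e : I e -> {ae P, forall w, Omeps e w}.
  move=> /Omeps1[mO PO]; exists (~` Omeps e); split => //.
    exact: measurableC.
  by rewrite probability_setC// PO subee//.
pose S w := 1 + `|C0 w| `^ p0 + `|C1 w| `^ p1 + `|C2 w| `^ p2 + `|C3 w| `^ p3 +
  `|C4 w| `^ p4 + `|A w| `^ p5 + `|B w| `^ p5 + `|G w| `^ p6.
have [K SK] : exists K, has_mean P S K.
  eexists; rewrite /S.
  do 8 (apply: has_meanD; last by split; [exact: in_Lp_integrable|reflexivity]).
  exact: has_mean_cst.
have S1 w : 1 <= S w.
  by rewrite /S -!addrA lerDl; do ?[apply: addr_ge0]; exact: powR_ge0.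
have S_ge0 w : 0 <= S w by exact: le_trans (S1 w).
have K0 : 0 <= K by case: SK => _ <-; exact: Rintegral_ge0.
have CS w : [/\ `|C0 w| <= S w `^ p0^-1, `|C1 w| <= S w `^ p1^-1,
    `|C2 w| <= S w `^ p2^-1 & `|C3 w| <= S w `^ p3^-1] /\
    [/\ `|C4 w| <= S w `^ p4^-1, `|A w| <= S w `^ p5^-1,
    `|B w| <= S w `^ p5^-1 & `|G w| <= S w `^ p6^-1].
  suff [[c0 c1 c2 c3] [c4 cA cB cG]] : [/\ `|C0 w| `^ p0 <= S w,
      `|C1 w| `^ p1 <= S w, `|C2 w| `^ p2 <= S w & `|C3 w| `^ p3 <= S w] /\
      [/\ `|C4 w| `^ p4 <= S w, `|A w| `^ p5 <= S w,
      `|B w| `^ p5 <= S w & `|G w| `^ p6 <= S w].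
    by split; split; exact: normr_le_powRV.
  rewrite /S; move: (powR_ge0 `|C0 w| p0) (powR_ge0 `|C1 w| p1)
    (powR_ge0 `|C2 w| p2) (powR_ge0 `|C3 w| p3) (powR_ge0 `|C4 w| p4)
    (powR_ge0 `|A w| p5) (powR_ge0 `|B w| p5) (powR_ge0 `|G w| p6).
  move: (`|C0 w| `^ p0) (`|C1 w| `^ p1) (`|C2 w| `^ p2) (`|C3 w| `^ p3)
    (`|C4 w| `^ p4) (`|A w| `^ p5) (`|B w| `^ p5) (`|G w| `^ p6).
  clear => x0 x1 x2 x3 x4 x5 x6 x7 *; by split; split; lra.
have CS0 w : C0 w <= S w `^ p0^-1 by apply: (le_trans (ler_norm _)); case: (CS w) => -[].
have CS1 w : C1 w <= S w `^ p1^-1 by apply: (le_trans (ler_norm _)); case: (CS w) => -[].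
have CS2 w : C2 w <= S w `^ p2^-1 by apply: (le_trans (ler_norm _)); case: (CS w) => -[].
have CS3 w : C3 w <= S w `^ p3^-1 by apply: (le_trans (ler_norm _)); case: (CS w) => -[].
have CS4 w : C4 w <= S w `^ p4^-1 by apply: (le_trans (ler_norm _)); case: (CS w) => _ [].
have CSA w : `|A w| <= S w `^ p5^-1 by case: (CS w) => _ [].
have CSB w : `|B w| <= S w `^ p5^-1 by case: (CS w) => _ [].
have CSG w : `|G w| <= S w `^ p6^-1 by case: (CS w) => _ [].
pose phi w (f : M -> R) := Rintegral m setT (fun x => Phi w x * f x).
have mPhi_w w : measurable_fun setT (Phi w).
  exact: (measurableT_comp mPhi (pair1_measurable w)).
have phi_le w f : Bw f -> `|phi w f| <= S w `^ p6^-1 * nw f.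
  move=> Bf; have [_] := ae_bounded_mul hBw (mPhi_w w) (Phi_fin w) Bf.
  move=> /le_trans; apply; apply: ler_wpM2r; first exact: fun_banach_ge0 hBw _ Bf.
  exact: CSG.
have phi_lin w : linear_form Bw (phi w).
  exact (linear_form_bounded_mul hBw (mPhi_w w) (Phi_fin w)).
have psi_lin : linear_form Bw psi by exact (linear_form_Rintegral hBw).
pose q e w := phi w (h e w).
have mq e : I e -> measurable_fun setT (q e).
  move=> Ie; have [mh _] := H5 e Ie.
  exact: (measurable_Rintegral_section m (measurable_funM mPhi mh)).
have q_int e : I e -> P.-integrable setT (EFin \o q e).
  move=> Ie; have [mh Hh] := H5 e Ie.
  apply: (proj1 (ae_dominated_Rintegral (g := S) (mq e Ie) (proj1 SK) S_ge0 _)).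
  apply: filterS (ae_Omeps e Ie) => w Ow.
  have [Bh /(_ Ow)[_ _ _ nh]] := Hh w.
  apply: (le_trans (phi_le w _ (Bs_w _ (Bss_s _ Bh)))).
  apply: (@le_trans _ _ (S w `^ p6^-1 * S w `^ p4^-1)).
    rewrite ler_wpM2l ?powR_ge0//; apply: (le_trans (nw_s _ (Bss_s _ Bh))).
    exact: (le_trans (ns_ss _ Bh) (le_trans nh (CS4 w))).
  have hq : p6^-1 + p4^-1 <= 1 by lra.
  have := @prod_powR_le _ (S w) [:: p6^-1; p4^-1] (S1 w).
  by rewrite !big_cons !big_nil addr0 mulr1; exact.
(* The bound of [orbit_quotient_bound] along the past orbit of [w] is a finite combination of [S]
   composed with iterates of [sigma_inv], so invariance makes its mean explicit. *)
pose bd (e : R) (N n : nat) (w : Om) : R :=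
  `|e| * (\sum_(j < N) j.+1%:R * (\sum_(i < j.+2) S (iter i sigma_inv w))) +
  \sum_(N <= j < n) 2 * j%:R `^ (- beta) *
     (S (iter 0 sigma_inv w) + S (iter j sigma_inv w) + S (iter j.+1 sigma_inv w)) +
  2 * `|e|^-1 * n%:R `^ (- beta) * (S (iter 0 sigma_inv w) + S (iter n sigma_inv w)).
pose kappa N : R := \sum_(j < N) j.+1%:R * (\sum_(i < j.+2) K).
have S_mean k : has_mean P (fun w => S (iter k sigma_inv w)) K.
  have [mk Pk] := iter_mp k; case: SK => Si <-.
  exact: (measure_preserving_Rintegral mk Pk S_ge0 Si).
have bd_mean e N n : has_mean P (bd e N n) (`|e| * kappa N +
    \sum_(N <= j < n) 2 * j%:R `^ (- beta) * (K + K + K) +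
    2 * `|e|^-1 * n%:R `^ (- beta) * (K + K)).
  apply: has_meanD; [apply: has_meanD|].
  - apply/has_meanZ/has_mean_sum => j; apply/has_meanZ/has_mean_sum => i.
    exact: S_mean.
  - apply: has_mean_sum => j; apply: has_meanZ.
    by apply: has_meanD; [apply: has_meanD|]; exact: S_mean.
  - by apply: has_meanZ; apply: has_meanD; exact: S_mean.
have bd_ge0 e N n w : 0 <= bd e N n w.
  rewrite /bd; apply: addr_ge0; [apply: addr_ge0|].
  - apply: mulr_ge0 => //; apply: sumr_ge0 => j _; apply: mulr_ge0 => //.
    exact: sumr_ge0.
  - by apply: sumr_ge0 => j _; rewrite !(mulr_ge0, addr_ge0) ?powR_ge0.
  - by rewrite !(mulr_ge0, addr_ge0) ?powR_ge0 ?invr_ge0.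
have pointwise e e' N n : I e -> I e' -> e != 0 -> e' != 0 -> (0 < N)%N -> (N <= n)%N ->
  {ae P, forall w, `|e^-1 * (q e w - q 0 w) - e'^-1 * (q e' w - q 0 w)|
     <= bd e N n w + bd e' N n w}.
  move=> Ie Ie' en en' N0 Nn.
  (* The sets for [0], [e], [e'] and the property [H4] are taken at all points of the past orbit;
     [H6] is taken at [w] alone, since it already ranges over the past. [choice] picks the operators
     [Lhat k] for this fixed [w], so no measurable selection is involved. *)
  apply: filterS (filterI (ae_orbit _ (ae_Omeps _ I0)) (filterI
    (ae_orbit _ (ae_Omeps _ Ie)) (filterI (ae_orbit _ (ae_Omeps _ Ie'))
    (filterI (ae_orbit _ H4) H6)))).
  move=> w [w0 [we [we' [/choice[Lhat HLhat] H6w]]]].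
  pose om k := iter k sigma_inv w.
  have omS k : sigma (om k.+1) = om k by rewrite /om iterS siK.
  have hss c k : I c -> Bss (h c (om k)) by move=> /H5[_ /(_ (om k))[]].
  have hE c k : I c -> (forall k, Omeps c (om k)) ->
      L c (om k.+1) (h c (om k.+1)) = h c (om k).
    by move=> /H5[_ /(_ (om k.+1))[_ +]] Oc => /(_ (Oc _))[_ -> _ _]; rewrite omS.
  have psih c k : I c -> (forall k, Omeps c (om k)) -> psi (h c (om k)) = 1.
    by move=> /H5[_ /(_ (om k))[_ +]] Oc => /(_ (Oc _))[].
  have hn c k : I c -> (forall k, Omeps c (om k)) ->
      nss (h c (om k)) <= S (om k) `^ p4^-1.
    move=> /H5[_ /(_ (om k))[_ +]] Oc => /(_ (Oc _))[_ _ _] /le_trans; apply.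
    exact: CS4.
  have Vhat k f : Bss f -> Vs (Lhat k f) by case: (HLhat k) => -[+ _] _ _; exact.
  have bound c : I c -> c != 0 -> (forall k, Omeps c (om k)) ->
      `|c^-1 * (q c w - q 0 w) - \sum_(j < N) phi w
         (cocycle (L 0) sigma j (om j) (Lhat j.+1 (h 0 (om j.+1))))| <= bd c N n w.
    move=> Ic c0 Oc.
    have c1 : `|c| <= 1.
      by move: Ic => /andP[ac cb]; rewrite ler_norml; apply/andP; split; lra.
    apply: (@orbit_quotient_bound R d2 M m Bw Bs Bss nw ns nss hBw hBs Bss_s Bs_w
      nw_s ns_ss Om sigma om omS psi (phi w) psi_lin (phi_lin w) (L 0) (L c) c c0 c1
      _ _ _ _ _ _ (fun k => S (om k)) (fun k => S1 (om k))
      _ _ _ _ _ _ _ beta q0_ge0 q1_ge0 q2_ge0 q3_ge0 q4_ge0 q5_ge0 q6_ge0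
      _ _ Lhat (fun k => h 0 (om k)) (fun k => h c (om k))) => //.
    - by move=> x; have [] := Lop 0 x I0.
    - by move=> x; have [] := Lop 0 x I0.
    - by move=> x; have [] := Lop c x Ic.
    - by move=> x; have [] := Lop c x Ic.
    - by move=> x; have [] := Lop 0 x I0.
    - by move=> x; have [] := Lop c x Ic.
    (* [H1] starts at [n = 1]; for [n = 0] the operator is the identity, and a power of [S w >= 1]
       with nonnegative exponent is at least [1]. *)
    - move=> [|k] f Bf.
        rewrite /= ler_peMl ?(fun_banach_ge0 hBw)//.
        rewrite -[leLHS](powRr0 (S w)).
        exact: ler_powR.
      apply: (le_trans (H1 k.+1 c w f isT Ic (Oc 0%N) Bf)).
      by apply: ler_wpM2r; [exact: (fun_banach_ge0 hBw)|exact: CS0].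
    - move=> k f k0 Vf; apply: (le_trans (H2 k c (om k) f k0 Ic (Oc k) Vf)).
      apply: ler_wpM2r; first by case: Vf => Bf _; exact: (fun_banach_ge0 hBs).
      by apply: ler_wpM2r; [exact: powR_ge0|exact: CS1].
    - move=> k f Bf; apply: (le_trans (H3 c (om k) f Ic (Oc k) Bf)).
      apply: ler_wpM2r; first exact: (fun_banach_ge0 hBs).
      by apply: ler_wpM2r => //; exact: CS2.
    - move=> k f Bf; have [_ + _] := HLhat k.
      move=> /(_ c f Ic c0 (Oc k) Bf) /le_trans; apply.
      apply: ler_wpM2r; first exact: (fun_banach_ge0 hBss).
      by apply: ler_wpM2r => //; exact: CS3.
    - move=> k f Bf; have [_ _ +] := HLhat k => /(_ f Bf) /le_trans; apply.
      by apply: ler_wpM2r; [exact: (fun_banach_ge0 hBss)|exact: CS3].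
    - by move=> k; exact: hss.
    - by move=> k; exact: hss.
    - by move=> k; exact: hE.
    - by move=> k; exact: hE.
    - by move=> k; rewrite !psih.
    - by move=> k; exact: hn.
    - by move=> k; exact: hn.
    - move=> k j f j0 kj Bf; apply: (le_trans (H6w j k f j0 kj Bf)).
      apply: ler_wpM2r; first exact: (fun_banach_ge0 hBs).
      apply: (le_trans (ler_norm _)); rewrite normrM.
      exact: ler_pM.
    - by move=> f; exact: phi_le.
  (* Triangle inequality through the sum of limit terms, which is the same for both parameters. *)
  apply: (le_trans (ler_distD (\sum_(j < N) phi w
    (cocycle (L 0) sigma j (om j) (Lhat j.+1 (h 0 (om j.+1))))) _ _)).
  apply: lerD; first exact: (bound e Ie en we).
  by rewrite distrC; exact: (bound e' Ie' en' we').
(* Each parameter contributes [2 * 3K] to the tail and [2 * 2K] to the remainder, so [12 * K] covers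
   both; [K + 1] makes the constant positive. *)
have mean_diff e e' N n : I e -> I e' -> e != 0 -> e' != 0 -> (0 < N)%N -> (N <= n)%N ->
  `|e^-1 * (mu_int e - mu_int 0) - e'^-1 * (mu_int e' - mu_int 0)| <=
   (`|e| + `|e'|) * kappa N + 12 * (K + 1) * \sum_(N <= j < n) j%:R `^ (- beta) +
   12 * (K + 1) * (`|e|^-1 + `|e'|^-1) * n%:R `^ (- beta).
  move=> Ie Ie' en en' N0 Nn.
  have [gi gE] := has_meanD (bd_mean e N n) (bd_mean e' N n).
  pose f e w := e^-1 * (q e w - q 0 w).
  have f_mean c : I c -> has_mean P (f c) (c^-1 * (mu_int c - mu_int 0)).
    move=> Ic; apply: has_meanZ.
    have := has_meanD (conj (q_int c Ic) erefl)
      (has_meanZ (-1) (conj (q_int 0 I0) erefl)).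
    rewrite mulN1r; congr has_mean; apply/funext => w; by rewrite mulN1r.
  have [fi fE] := has_meanD (f_mean _ Ie) (has_meanZ (-1) (f_mean _ Ie')).
  have fE' : (fun w => f e w + -1 * f e' w) = (fun w => f e w - f e' w).
    by apply/funext => w; rewrite mulN1r.
  rewrite mulN1r fE' in fE; rewrite fE' in fi; rewrite -fE.
  have mf : measurable_fun setT (fun w => f e w - f e' w).
    exact/measurable_EFinP/(measurable_int P).
  have [_ /le_trans] := ae_dominated_Rintegral mf gi
    (fun w => addr_ge0 (bd_ge0 e N n w) (bd_ge0 e' N n w))
    (pointwise e e' N n Ie Ie' en en' N0 Nn).
  apply; rewrite gE -!mulr_suml -!mulr_sumr.
  set s := \sum_(N <= j < n) _.
  have s0 : 0 <= s by apply: sumr_ge0 => j _; exact: powR_ge0.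
  have t0 : 0 <= (`|e|^-1 + `|e'|^-1) * n%:R `^ (- beta).
    by rewrite mulr_ge0 ?powR_ge0// addr_ge0// invr_ge0.
  rewrite -subr_ge0 (_ : _ - _ = 12 * s + (8 * K + 12) *
    ((`|e|^-1 + `|e'|^-1) * n%:R `^ (- beta))); last by ring.
  by rewrite !(addr_ge0, mulr_ge0).
apply: derivable_cauchy.
(* [r] is the distance from [0] to the nearer end of [I]. *)
pose r := Num.min (- a) b.
have r0 : 0 < r by rewrite lt_min oppr_gt0 a0 b0.
have Ir e : `|e| < r -> I e.
  rewrite lt_min ltr_norml opprK /I/= => /andP[/andP[-> _]].
  by rewrite ltr_norml => /andP[_ ->].
apply: (@quotient_cauchy R (fun e => e^-1 * (mu_int e - mu_int 0))
   (12 * (K + 1)) beta r kappa) => //.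
- by rewrite mulr_gt0// ltr_wpDl.
- by move=> N; apply: sumr_ge0 => j _; rewrite mulr_ge0// sumr_ge0.
- by move=> e e' N n en en' er er' N0 Nn; apply: mean_diff => //; exact: Ir.
Qed.
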